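(* Let $F$ be a graph with chromatic number $\chi(F)>3$. Then there exist $\beta>0$ and $s_0$ such that, for all integers $n,s$ with $\max\{s_0,\,n/2-\beta n\}<s<n/2$, $$\mathrm{ex}(n,\{F,M_{s+1}\})=\mathrm{ex}(2s+1,F).$$
   Context: Graphs are finite and simple. $M_{s+1}$ denotes the graph consisting of $s+1$ pairwise disjoint edges (a matching of size $s+1$). For a family $\mathcal F$ of graphs, a graph is $\mathcal F$-free if it contains no member of $\mathcal F$ as a (not necessarily induced) subgraph; $\mathrm{ex}(n,\mathcal F)$ is the maximum number of edges in an $n$-vertex $\mathcal F$-free graph, and $\mathrm{ex}(n,F)=\mathrm{ex}(n,\{F\})$. *)

(* Defs.v *)
From HB Require Import structures.
From mathcomp Require Import all_boot all_order all_algebra.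
From mathcomp Require Import boolp reals.

Set Implicit Arguments.
Unset Strict Implicit.
Unset Printing Implicit Defensive.

(* [sgraph V] is the finite type of all simple graphs with vertex set [V], so
   that one can maximise over it; [graph] also packs the vertex set. *)
Record sgraph (V : finType) := SGraph {
  edges : {set {set V}};
  edges_card2 : [forall e in edges, #|e| == 2]
}.

HB.instance Definition _ (V : finType) := [isSub for @edges V].
HB.instance Definition _ (V : finType) := [Countable of sgraph V by <:].
HB.instance Definition _ (V : finType) := [Finite of sgraph V by <:].

Record graph := Graph {
  vertex : finType;
  sgraph_of :> sgraph vertex
}.

Definition adjacent (V : finType) (G : sgraph V) (x y : V) : bool :=
  [set x; y] \in edges G.

Definition colorable (V : finType) (G : sgraph V) (k : nat) : bool :=
  [exists c : {ffun V -> 'I_k},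
    [forall x, forall y, adjacent G x y ==> (c x != c y)]].

Lemma adjacent_neq (V : finType) (G : sgraph V) (x y : V) :
  adjacent G x y -> x != y.
Proof. by move=> /(forall_inP (edges_card2 G)); rewrite cards2; case: (x != y). Qed.

Lemma colorable_exists (V : finType) (G : sgraph V) : exists k, colorable G k.
Proof.
exists #|V|; apply/existsP; exists (finfun (@enum_rank V)).
apply/forallP=> x; apply/forallP=> y; apply/implyP=> /adjacent_neq.
by rewrite !ffunE (inj_eq enum_rank_inj).
Qed.

Definition chromatic_number (V : finType) (G : sgraph V) : nat :=
  ex_minn (colorable_exists G).

Definition has_subgraph (V W : finType) (G : sgraph V) (H : sgraph W) : bool :=
  [exists f : {ffun W -> V}, injectiveb f &&
    [forall x, forall y, adjacent H x y ==> adjacent G (f x) (f y)]].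

(* [classical_sets.set graph] is a universe inconsistency: [graph] contains
   [finType]. *)
Definition family := graph -> Prop.

Definition family1 (F : graph) : family := fun H => H = F.

Definition family2 (F1 F2 : graph) : family := fun H => H = F1 \/ H = F2.

Definition is_free (FF : family) (V : finType) (G : sgraph V) : Prop :=
  forall H : graph, FF H -> ~~ has_subgraph G H.

(* Every n-vertex graph is isomorphic to one on 'I_n.  The value is 0 when no
   n-vertex graph is FF-free. *)
Definition ex (n : nat) (FF : family) : nat :=
  \max_(G : sgraph 'I_n | `[< is_free FF G >]) #|edges G|.

Definition matching_edges (k : nat) : {set {set 'I_k * bool}} :=
  [set [set (i, false); (i, true)] | i : 'I_k].

Lemma matching_edges_card2 (k : nat) :
  [forall e in matching_edges k, #|e| == 2].
Proof. by apply/forall_inP=> _ /imsetP[i _ ->]; rewrite cards2 xpair_eqE andbF. Qed.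

Definition matching (k : nat) : graph := Graph (SGraph (matching_edges_card2 k)).

(* Main.v *)
(** Write x(m) = ex(m, F) and r = chi(F) - 1 >= 3.

    Growth: x(m+1) >= x(m) + 3m/5 for large m.  If B is a set of |F| vertices of
    an F-free graph, a new vertex joined exactly to the common neighbours of B
    creates no copy of F, since a copy through the new vertex misses some vertex
    of B, which can take its place.  An extremal graph contains a subgraph on
    almost all vertices with minimum degree about (1 - 1/r) m; by Erdos-Stone it
    contains a large complete r-partite graph with parts A_i, and no such
    (r+1)-partite graph.  Hence almost every vertex is joined to little of one
    part and nearly all of the others, and inside a part A_i that is missed by at
    most m/r vertices one finds |F| vertices with about (1 - 1/r) m >= 0.64 m
    common neighbours.

    Upper bound: let D be the set of vertices of degree at most 11n/20.  Deleting
    n/100 vertices of D costs less than the growth of x, so |D| <= n/100 may be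
    assumed.  Take a maximum matching covering as many vertices of D as possible,
    and let P be the covered part of D.  Two uncovered vertices outside D would
    yield an augmentation by their degrees, so |P| <= 2s + 1 - (n - |D|).  An
    uncovered vertex of D has all its neighbours in P or matched to P.  So D
    carries at most (11n/20 + 2|D|)|P| edges, which is less than
    x(2s + 1) - x(n - |D|) by growth. *)

Require Import Defs.
From mathcomp Require Import all_boot all_order all_algebra.
From mathcomp Require Import boolp reals.
From mathcomp Require Import zify lra ring.
Import Order.TTheory GRing.Theory Num.Theory.

Set Implicit Arguments.
Unset Strict Implicit.
Unset Printing Implicit Defensive.

(** * Graphs as relations *)

Definition simple (V : finType) (e : rel V) := symmetric e /\ irreflexive e.

Definition nbr (V : finType) (e : rel V) (x : V) : {set V} := [set y | e x y].

(* Ordered pairs: each edge inside [S] counts twice. *)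
Definition arcs (V : finType) (e : rel V) (S : {set V}) : nat :=
  \sum_(x in S) #|nbr e x :&: S|.

(** Stated for a bare relation, so that passing to an induced subgraph is [relpre val e], with no
    edge set to rebuild. *)
Definition embeds (W : finType) (H : sgraph W) (V : finType) (e : rel V) :=
  exists g : W -> V, injective g /\ forall x y, adjacent H x y -> e (g x) (g y).

Lemma adjacent_simple (V : finType) (G : sgraph V) : simple (adjacent G).
Proof.
split=> [x y | x]; first by rewrite /adjacent setUC.
by apply/negP=> /adjacent_neq; rewrite eqxx.
Qed.

Lemma has_subgraphP (V W : finType) (G : sgraph V) (H : sgraph W) :
  reflect (embeds H (adjacent G)) (has_subgraph G H).
Proof.
apply: (iffP existsP) => [[g /andP[/injectiveP gI /forallP gH]] | [g [gI gH]]].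
  by exists g; split=> // x y; apply/implyP; move/forallP: (gH x).
exists (finfun g); apply/andP; split.
  by apply/injectiveP=> x y; rewrite !ffunE; apply: gI.
by apply/forallP=> x; apply/forallP=> y; rewrite !ffunE; apply/implyP/gH.
Qed.

Lemma embeds_relpre (W : finType) (H : sgraph W) (U V : finType) (e : rel V)
    (i : U -> V) : injective i -> embeds H (relpre i e) -> embeds H e.
Proof.
by move=> iI [g [gI gH]]; exists (i \o g); split; [apply: inj_comp | apply: gH].
Qed.

Section GraphOfRel.
Variables (V : finType) (e : rel V).
Hypothesis eS : simple e.

Definition rel_edges : {set {set V}} :=
  [set [set p.1; p.2] | p in [pred p : V * V | e p.1 p.2]].

Lemma rel_edges_card2 : [forall E in rel_edges, #|E| == 2].
Proof.
apply/forall_inP=> _ /imsetP[[x y] /= exy ->]; rewrite cards2 /=.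
have [xy|//] := eqVneq x y; by rewrite xy inE /= eS.2 in exy.
Qed.

Definition graph_of_rel : sgraph V := SGraph rel_edges_card2.

Lemma adjacent_graph_of_rel : adjacent graph_of_rel =2 e.
Proof.
move=> x y; apply/imsetP/idP => [[[a b] /= eab] | exy]; last by exists (x, y).
rewrite inE /= in eab => xyE.
have nab : a != b by apply: contraTneq eab => ->; rewrite eS.2.
have nxy : x != y.
  by have := congr1 (fun S => #|pred_of_set S|) xyE; rewrite /= !cards2 nab; case: (x != y).
have := set22 x y; have := set21 x y; rewrite xyE !inE.
move=> /orP[]/eqP xE /orP[]/eqP yE; move: nxy; rewrite xE yE ?eqxx //.
by rewrite eS.1.
Qed.
End GraphOfRel.

(** Handshake: both sides count the incident pairs of a vertex and an edge. *)
Lemma arcs_adjacent (V : finType) (G : sgraph V) :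
  arcs (adjacent G) [set: V] = 2 * #|edges G|.
Proof.
transitivity (\sum_(E in edges G) #|E|); last first.
  rewrite (eq_bigr (fun=> 2)) ?sum_nat_const 1?mulnC // => E EG.
  by apply/eqP; move/forall_inP: (edges_card2 G); apply.
transitivity (\sum_(E in edges G) \sum_(x in E) 1); last first.
  by apply: eq_bigr => E _; rewrite sum1_card.
rewrite (exchange_big_dep predT) //= /arcs; apply: eq_big => [x|x _].
  by rewrite inE.
rewrite setIT -sum1_card sum1_card.
have sI : {in nbr (adjacent G) x &, injective (fun y => [set x; y])}.
  move=> y z; rewrite !inE => /adjacent_neq xy _ /setP/(_ y).
  by rewrite !inE eqxx orbT eq_sym (negPf xy) => /esym/eqP.
rewrite -(card_in_imset sI) sum1_card; apply: eq_card => E.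
apply/imsetP/andP => [[y] | [EG xE]].
  by move=> xy ->; split; rewrite ?inE ?eqxx //; move: xy; rewrite !inE.
have /cards2P[a [b [ab EE]]] : #|E| == 2.
  by move/forall_inP: (edges_card2 G); apply.
move: xE; rewrite EE !inE => /orP[]/eqP->; [exists b | exists a]; rewrite ?inE.
- by rewrite /adjacent -EE.
- by [].
- by rewrite /adjacent setUC -EE.
by rewrite setUC.
Qed.

Lemma card_nbr_sub (V : finType) (e : rel V) (S : {set V}) (v : {v | v \in S}) :
  #|nbr (relpre val e) v| = #|nbr e (val v) :&: S|.
Proof.
rewrite -(card_imset _ val_inj); apply: eq_card => y.
rewrite !inE; apply/imsetP/andP => [[w] | [evy yS]].
  by rewrite inE /= => ? ->; split=> //; apply: (valP w).
by exists (Sub y yS); rewrite // inE.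
Qed.

Section Degrees.
Variables (V : finType) (e : rel V).
Hypothesis eS : simple e.

Lemma arcsD1 (S : {set V}) x : x \in S ->
  arcs e S = arcs e (S :\ x) + 2 * #|nbr e x :&: S|.
Proof.
move=> xS; rewrite /arcs (big_setD1 x) //= addnC mul2n -addnn addnA; congr (_ + _).
have -> : #|nbr e x :&: S| = \sum_(y in S :\ x) e x y.
  rewrite -big_mkcondr /= sum1_card; apply: eq_card => y.
  rewrite [RHS]unfold_in /= in_setD1 in_setI inE.
  by case: eqP => [->|]; rewrite ?eS.2 ?andbF //= andbC.
rewrite -big_split /=; apply: eq_bigr => y; rewrite !inE => /andP[yx yS].
rewrite (cardsD1 x) !inE xS andbT addnC eS.1; congr (_ + _).
by apply: eq_card => z; rewrite !inE andbCA.
Qed.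
End Degrees.

Section Ex.
Variables (F : graph).
Notation x m := (ex m (family1 F)).

Lemma family1_free (V : finType) (G : sgraph V) :
  is_free (family1 F) G <-> ~ embeds F (adjacent G).
Proof.
split=> [/(_ F erefl)/has_subgraphP // | nF H ->].
exact/has_subgraphP.
Qed.

(** [ex] only ranges over graphs on ordinals; the enumeration of [V] carries [e] there. *)
Lemma arcs_le_ex (V : finType) (e : rel V) : simple e -> ~ embeds F e ->
  arcs e setT <= 2 * x #|V|.
Proof.
move=> eS nF; pose e' : rel 'I_#|V| := relpre enum_val e.
have e'S : simple e'.
  by split=> [a b|a]; rewrite /e' /= ?eS.2 // eS.1.
have ee' : adjacent (graph_of_rel e'S) =2 e' by apply: adjacent_graph_of_rel.
have -> : arcs e setT = arcs (adjacent (graph_of_rel e'S)) setT.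
  rewrite /arcs (reindex (@enum_val V predT)); last first.
    by apply: onW_bij; apply: enum_val_bij.
  apply: eq_big => [v|v _]; rewrite ?inE // !setIT.
  rewrite -(card_imset _ enum_val_inj); apply: eq_card => y.
  rewrite inE; apply/idP/imsetP => [evy | [w]].
    by exists (enum_rank y); rewrite ?enum_rankK // inE ee' /= /e' /= enum_rankK.
  by rewrite inE ee' /e' /= => ? ->.
rewrite arcs_adjacent leq_mul2l /=; apply: (@leq_bigmax_cond _ _ (fun G => #|edges G|) (graph_of_rel e'S)).
apply/asboolP/family1_free => -[g [gI gH]]; apply: nF.
apply: (embeds_relpre enum_val_inj); exists g; split=> // a b /gH.
by rewrite ee'.
Qed.

Lemma arcs_in_le_ex (V : finType) (e : rel V) (S : {set V}) :
  simple e -> ~ embeds F e -> arcs e S <= 2 * x #|S|.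
Proof.
move=> eS nF; pose U := {v | v \in S}; pose e' : rel U := relpre val e.
have -> : arcs e S = arcs e' setT.
  rewrite /arcs [RHS](eq_bigl predT) => [|v]; last by rewrite inE.
  by rewrite big_sub; apply: eq_bigr => v _; rewrite setIT -card_nbr_sub.
have -> : #|S| = #|{: U}| by rewrite card_sig.
apply: arcs_le_ex; last by move/(embeds_relpre val_inj).
by split=> [a b|a]; rewrite /e' /= ?eS.2 // eS.1.
Qed.

(** The hypothesis makes the edgeless graph [F]-free, so the maximum in [ex] runs over a nonempty
    set and 0 is not just the default value. *)
Lemma ex_attained m : ~ embeds F (fun _ _ : 'I_m => false) ->
  exists e : rel 'I_m, [/\ simple e, ~ embeds F e & arcs e setT = 2 * x m].
Proof.
move=> nF; have e0S : simple (fun _ _ : 'I_m => false) by split.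
have P0 : `[< is_free (family1 F) (graph_of_rel e0S) >].
  apply/asboolP/family1_free => -[g [gI gH]]; apply: nF; exists g; split=> //.
  by move=> a b /gH; rewrite adjacent_graph_of_rel.
have [|G /asboolP/family1_free GF GE] :=
  eq_bigmax_cond (fun G : sgraph 'I_m => #|edges G|)
    (A := [pred G | `[< is_free (family1 F) G >]]).
  by apply/card_gt0P; eexists; apply: P0.
exists (adjacent G); split=> //; first exact: adjacent_simple.
by rewrite arcs_adjacent -GE.
Qed.
End Ex.

(** * Complete multipartite subgraphs *)

Definition blowup (V : finType) (e : rel V) (q T : nat) (A : 'I_q -> {set V}) :=
  (forall i, #|A i| = T) /\
  (forall i j x y, i != j -> x \in A i -> y \in A j -> e x y).

Definition has_blowup (V : finType) (e : rel V) (q T : nat) :=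
  exists A : 'I_q -> {set V}, blowup e T A.

Lemma exists_subset_card (V : finType) (S : {set V}) t :
  t <= #|S| -> exists B : {set V}, B \subset S /\ #|B| = t.
Proof.
move=> tS; have : 0 < 'C(#|S|, t) by rewrite bin_gt0.
by rewrite -cards_draws => /card_gt0P[B]; rewrite inE => /andP[BS /eqP]; exists B.
Qed.

(** Vertex [w] goes to the element of index [enum_rank w] in the part of its colour. Vertices of
    different colours stay distinct because a vertex shared by two parts would carry a loop. *)
Lemma blowup_embeds (F : graph) (V : finType) (e : rel V) q :
  irreflexive e -> colorable F q -> has_blowup e q #|vertex F| -> embeds F e.
Proof.
move=> eI /existsP[c /forallP cP] [A [AT Ae]].
have rk (w : vertex F) i : enum_rank w < #|A i| by rewrite AT ltn_ord.
pose g w := enum_val (Ordinal (rk w (c w))).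
have gA w : g w \in A (c w) by apply: enum_valP.
exists g; split=> [w w' gE | w w' ww']; last first.
  by apply: Ae (gA w) (gA w'); move/forallP/(_ w')/implyP: (cP w); apply.
have [cE | cN] := eqVneq (c w) (c w'); last first.
  by have := Ae _ _ _ _ cN (gA w) (gA w'); rewrite gE eI.
apply/enum_rank_inj/val_inj.
move: gE; rewrite /g; move: (rk w (c w)) (rk w' (c w')); rewrite cE => r1 r2.
by move/enum_val_inj => -[].
Qed.

Lemma card_bigcup_le (V I : finType) (Q : pred I) (A : I -> {set V}) :
  #|\bigcup_(i | Q i) A i| <= \sum_(i | Q i) #|A i|.
Proof.
elim/big_rec2: _ => [|i m B _ mB]; first by rewrite cards0.
by rewrite (leq_trans (leq_card_setU _ _)) // leq_add2l.
Qed.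

Section BlowupCount.
Variables (V : finType) (e : rel V).
Hypothesis eS : simple e.
Variables (q T t : nat) (A : 'I_q -> {set V}).
Hypothesis bA : blowup e T A.

Let full : {set V} := [set v | [forall i, t <= #|nbr e v :&: A i|]].

(* Pigeonhole on the traces of neighbourhoods on the union of the parts: [t]
   vertices with equal trace form a new part. *)
Lemma full_small : ~ has_blowup e q.+1 t -> #|full| <= t * 2 ^ (q * T).
Proof.
move=> nB; pose U := \bigcup_i A i.
have cU : #|U| <= q * T.
  rewrite (leq_trans (card_bigcup_le _ _)) // (eq_bigr (fun=> T)) => [|i _].
    by rewrite sum_nat_const card_ord.
  exact: bA.1.
rewrite -sum1_card (partition_big (fun v => nbr e v :&: U) (mem (powerset U))) /=; last first.
  by move=> v _; rewrite powersetE subsetIr.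
apply: (@leq_trans (\sum_(Z in powerset U) t)); last first.
  rewrite sum_nat_const card_powerset mulnC leq_mul2l leq_exp2l //.
  by rewrite cU orbT.
apply: leq_sum => Z ZU; rewrite leqNgt; apply/negP => tZ.
apply: nB.
rewrite sum1_card in tZ; pose P := [set v in full | nbr e v :&: U == Z].
have tP : t < #|P| by rewrite (leq_trans tZ) // subset_leq_card //; apply/subsetP=> v; rewrite inE.
have [v0] : exists v0, v0 \in P by apply/card_gt0P; apply: leq_ltn_trans tP.
rewrite !inE => /andP[/forallP v0t /eqP v0Z].
have [C [CP Ct]] := exists_subset_card (ltnW tP).
have /choice[B BP] i : exists B : {set V}, B \subset nbr e v0 :&: A i /\ #|B| = t.
  exact: exists_subset_card.
have BA i y : y \in B i -> y \in A i.
  by case: (BP i) => /subsetP Bs _ /Bs; rewrite inE => /andP[].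
have CB i x y : x \in C -> y \in B i -> e x y.
  move=> xC yB; have yA := BA _ _ yB; have := subsetP CP x xC; rewrite inE => /andP[_ /eqP xZ].
  suff: y \in nbr e x :&: U by rewrite !inE => /andP[].
  rewrite xZ -v0Z inE; case: (BP i) => /subsetP/(_ y yB); rewrite inE => /andP[-> _] _.
  by apply/bigcupP; exists i.
exists (fun k => if unlift ord0 k is Some i then B i else C); split=> [k | k l x y].
  by case: unliftP => [i|] _ //; case: (BP i).
case: unliftP => [i ->|->]; case: unliftP => [j ->|->]; rewrite ?eqxx //.
- by rewrite (inj_eq lift_inj) => ij /BA xA /BA; apply: bA.2 xA.
- by move=> _ xB yC; rewrite eS.1; apply: CB xB.
by move=> _; apply: CB.
Qed.

Hypothesis nB : ~ has_blowup e q.+1 t.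
Hypothesis q_gt0 : 0 < q.
Variable d : nat.
Hypothesis dP : forall v, d <= #|nbr e v|.

Let C := t * 2 ^ (q * T).

(** Double counting of the arcs between all vertices and the [q * T] vertices of the parts, each of
    degree at least [d]. *)
Lemma arcs_blowup_ge : q * T * d <= \sum_v \sum_i #|nbr e v :&: A i|.
Proof.
rewrite exchange_big /= -mulnA -[X in X * _](card_ord q) -sum_nat_const.
apply: leq_sum => i _; rewrite -(bA.1 i) -sum_nat_const.
have -> : \sum_v #|nbr e v :&: A i| = \sum_(a in A i) #|nbr e a|.
  under eq_bigr do rewrite -sum1_card.
  rewrite (exchange_big_dep (mem (A i))) /= => [|v a _]; last by rewrite inE => /andP[].
  apply: eq_bigr => a aA; rewrite -sum1_card; apply: eq_bigl => v.
  by rewrite !inE aA andbT eS.1.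
by apply: leq_sum.
Qed.

(* Off [full], a part in which [v] has fewer than [t] neighbours; arbitrary on
   [full]. *)
Let short (v : V) : 'I_q :=
  odflt (Ordinal q_gt0) [pick i | #|nbr e v :&: A i| < t].

(** For [a] in part [i], these are the exceptional non-neighbours: vertices whose short part is
    another one, and which should therefore see nearly all of part [i]. *)
Let missing i a : {set V} := [set v | [&& v \notin full, short v != i & ~~ e a v]].

Lemma short_lt v : v \notin full -> #|nbr e v :&: A (short v)| < t.
Proof.
rewrite inE negb_forall => /existsP[i]; rewrite -ltnNge => vi.
by rewrite /short; case: pickP => [//|/(_ i)]; rewrite vi.
Qed.

Lemma card_nbr_blowup v i : #|nbr e v :&: A i| <= T.
Proof. by rewrite -(bA.1 i) subset_leq_card ?subsetIr. Qed.

(** A vertex off [full] sends fewer than [t] arcs to its short part and at most [T] to each other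
    part, and every missing pair lowers this count by one. Vertices of [full] send at most [q * T].
    Summing over all vertices and comparing with [arcs_blowup_ge] bounds the missing pairs. *)
Lemma missing_sum i :
  \sum_(a in A i) #|missing i a| + q * T * d <=
  C * (q * T) + #|V| * (q.-1 * T + t).
Proof.
apply: (leq_trans (leq_add (leqnn _) arcs_blowup_ge)).
have -> : \sum_(a in A i) #|missing i a| =
          \sum_v ((v \notin full) && (short v != i)) * (T - #|nbr e v :&: A i|).
  under eq_bigr do rewrite -sum1_card.
  rewrite (exchange_big_dep predT) //=; apply: eq_bigr => v _.
  under eq_bigl do rewrite inE.
  case: (v \notin full) => /=; last by rewrite big_pred0 // => a; rewrite andbF.
  case: (short v != i) => /=; last by rewrite big_pred0 // => a; rewrite andbF.
  rewrite mul1n -(bA.1 i) -cardsDS ?subsetIr // sum1_card; apply: eq_card => a.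
  by rewrite unfold_in /= !inE eS.1; case: (a \in A i); rewrite ?andbF ?andbT.
rewrite -big_split /=.
apply: (@leq_trans (\sum_v ((v \in full) * (q * T) + (q.-1 * T + t)))).
  apply: leq_sum => v _; have [vW | vW] /= := boolP (v \in full).
    rewrite mul1n mul0n add0n (leq_trans _ (leq_addr _ _)) //.
    rewrite -[X in _ <= X * _](card_ord q) -sum_nat_const; apply: leq_sum => j _.
    exact: card_nbr_blowup.
  have sT (P : pred 'I_q) : \sum_(j | P j) #|nbr e v :&: A j| <= #|P| * T.
    by rewrite -sum_nat_const; apply: leq_sum => j _; apply: card_nbr_blowup.
  rewrite mul0n add0n (bigD1 (short v)) //= addnCA addnC leq_add //; last exact/ltnW/short_lt.
  have [si | si] /= := eqVneq (short v) i.
    by rewrite mul0n add0n (leq_trans (sT _)) // cardC1 card_ord.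
  rewrite mul1n (bigD1 i) 1?eq_sym //= addnA subnK ?card_nbr_blowup //.
  have -> : q.-1 * T = T + q.-2 * T.
    rewrite -mulSn; congr (_ * _).
    have := ltn_ord (short v); have := ltn_ord i; move: si; rewrite -val_eqE /=; lia.
  rewrite leq_add2l (leq_trans (sT _)) // leq_mul2r; apply/orP; right.
  rewrite (@leq_trans #|~: [set short v; i]|) //.
    by apply/subset_leq_card/subsetP => j; rewrite !inE negb_or.
  by have := cardsC [set short v; i]; rewrite cards2 card_ord si; lia.
rewrite big_split /= sum_nat_const leq_add //.
rewrite -big_distrl /= leq_mul2r; apply/orP; right.
rewrite (leq_trans _ (full_small nB)) // -sum1_card [X in _ <= X]big_mkcond /=.
by apply: leq_sum => v _; case: (v \in full).
Qed.

Lemma blowup_min_degree :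
  q * T * d <= C * (q * T) + #|V| * (q.-1 * T + t).
Proof. exact: leq_trans (leq_addl _ _) (missing_sum (Ordinal q_gt0)). Qed.

(** The set [B] is taken inside one part [A i]. Its common neighbours are all vertices except those
    in [full], those short on [i], and at most [L] missing ones for each element of [B]. *)
Lemma blowup_common_nbr f L :
    C * (q * T) + #|V| * (q.-1 * T + t) < q * T * d + L.+1 * (T.+1 - f) ->
  exists B : {set V}, #|B| = f /\
    q * #|V| <= #|V| + q * (C + f * L + #|[set v | [forall b in B, e b v]]|).
Proof.
move=> fL; pose part i := [set v | (v \notin full) && (short v == i)].
(* The [q] classes of vertices by short part are disjoint, so one has at most [#|V| / q]
   elements. *)
have [i iP] : exists i, q * #|part i| <= #|V|.
  apply/existsP; apply: contraT; rewrite negb_exists => /forallP h.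
  have : \sum_(i < q) #|V|.+1 <= \sum_(i < q) q * #|part i|.
    by apply: leq_sum => i _; rewrite ltnNge.
  rewrite sum_nat_const card_ord -big_distrr /= leq_pmul2l // => /leq_trans.
  move/(_ #|V|); rewrite ltnn => -> //.
  rewrite -(@sum1_card V) (partition_big short predT) //= leq_sum // => j _.
  rewrite -sum1_card (eq_bigl (fun v => (v \notin full) && (short v == j))) => [|v]; last by rewrite inE.
  by rewrite big_mkcondl /= leq_sum // => v _; case: ifP.
(* With fewer than [f] good vertices, at least [T.+1 - f] vertices of [A i] would each have at least
   [L.+1] missing vertices, against [fL] and [missing_sum]. *)
pose good := [set a in A i | #|missing i a| <= L].
have fgood : f <= #|good|.
  rewrite leqNgt; apply/negP => gf; have := missing_sum i.
  apply/negP; rewrite -ltnNge; apply: (leq_trans fL).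
  rewrite addnC leq_add2r (big_setID good) /= (leq_trans _ (leq_addl _ _)) //.
  apply: (@leq_trans (\sum_(a in A i :\: good) L.+1)).
    rewrite sum_nat_const mulnC leq_mul2r; apply/orP; right.
    rewrite cardsDS ?bA.1; first by lia.
    by apply/subsetP=> a; rewrite inE => /andP[].
  apply: leq_sum => a; rewrite !inE => /andP[+ aA].
  by rewrite aA /= -ltnNge.
have [B [Bg Bf]] := exists_subset_card fgood.
exists B; split=> //.
set N := [set v | _].
have : #|V| <= #|full :|: part i :|: \bigcup_(a in B) missing i a :|: N|.
  rewrite -cardsT; apply/subset_leq_card/subsetP => v _; rewrite !in_setU [v \in part i]inE [v \in N]inE.
  have [//|/= vW] := boolP (v \in full).
  have [//|/= vi] := boolP (short v == i).
  have [vB | nvB] := boolP [forall b in B, e b v]; first by rewrite !orbT.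
  rewrite orbF; apply/bigcupP.
  move: nvB; rewrite negb_forall_in => /exists_inP[b bB nb].
  by exists b; rewrite // inE vW vi.
have U1 : #|\bigcup_(a in B) missing i a| <= f * L.
  apply: (@leq_trans (\sum_(a in B) L)); last by rewrite sum_nat_const Bf.
  apply: leq_trans (card_bigcup_le _ _) _.
  by apply: leq_sum => a /(subsetP Bg); rewrite inE => /andP[].
move/leq_trans/(_ (leq_card_setU _ _)) => U2.
have U3 : #|full :|: part i :|: \bigcup_(a in B) missing i a| <= C + #|part i| + f * L.
  rewrite (leq_trans (leq_card_setU _ _)) // leq_add //.
  by rewrite (leq_trans (leq_card_setU _ _)) // leq_add2r full_small.
have U4 : #|V| <= C + #|part i| + f * L + #|N| by rewrite (leq_trans U2) ?leq_add2r.
move: iP U4; move: (#|part i|) (#|N|) => p n' iP U4.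
rewrite (@leq_trans (q * (C + p + f * L + n'))) ?leq_mul2l ?U4 ?orbT //.
by rewrite !mulnDr; lia.
Qed.
End BlowupCount.

Local Open Scope ring_scope.

(** * Erdos-Stone under a minimum degree condition *)

Lemma nat_upper_bound (K : archiRealFieldType) (x : K) : exists n : nat, x <= n%:R.
Proof.
exists (Num.bound `|x|); apply: (le_trans (ler_norm x)).
by apply/ltW/archi_boundP/normr_ge0.
Qed.

Lemma min_degree_attained (V : finType) (e : rel V) : (0 < #|V|)%N ->
  exists v, forall w, (#|nbr e v| <= #|nbr e w|)%N.
Proof.
case/card_gt0P=> v0 _; exists [arg min_(v < v0) #|nbr e v|]%N.
by case: arg_minnP => // v _ vP w; apply: vP.
Qed.

Lemma blowup_extend (K : archiRealFieldType) q (eta : K) T : (0 < q)%N -> 0 < eta ->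
  exists T' m0 : nat, forall (V : finType) (e : rel V), simple e ->
    (m0 <= #|V|)%N ->
    (forall v, (1 - q%:R^-1 + eta) * #|V|%:R <= #|nbr e v|%:R) ->
    has_blowup e q T' -> has_blowup e q.+1 T.
Proof.
(* The surplus [eta] in the degrees has to beat two errors in [blowup_min_degree]. Half of it beats
   the term in [T] once [X] is large, the other half beats the bound [C] on [full] once [#|V|] is
   large. *)
move=> q0 eta0; have [X XP] := nat_upper_bound ((2 * T%:R + 1) / eta).
have [C CE0] : exists C, C = (T * 2 ^ (q * X))%N by eexists.
have [m0 m0P] := nat_upper_bound (2 * C%:R / eta + 1).
exists X, m0 => V e eS mV degP [A bA]; apply: contrapT => nB.
have V0 : (0 < #|V|)%N.
  rewrite (leq_trans _ mV) // -(ltr_nat K); apply: lt_le_trans m0P.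
  by rewrite ltr_wpDl // divr_ge0 ?mulr_ge0 // ltW.
have [v0 v0P] := min_degree_attained e V0.
have := blowup_min_degree eS bA nB q0 v0P.
rewrite -CE0 -(ler_nat K) !(natrD, natrM) => cnt.
have m0V : m0%:R <= #|V|%:R :> K by rewrite ler_nat.
have q1 : 1 <= q%:R :> K by rewrite ler1n.
have qE : (q.-1)%:R = q%:R - 1 :> K by rewrite -subn1 natrB.
rewrite qE in cnt.
have XE : 2 * T%:R + 1 <= X%:R * eta by rewrite -ler_pdivrMr.
have CE : 2 * C%:R < #|V|%:R * eta.
  by rewrite -ltr_pdivrMr //; lra.
have dE := degP v0.
have T0 : 0 <= T%:R :> K by [].
have V1 : 0 < #|V|%:R :> K by rewrite ltr0n.
move: (#|V|%:R) (#|_|%:R) (X%:R) (C%:R) (T%:R) (q%:R) q1 XE CE dE T0 V1 cnt => m d x c t Q.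
move=> Q1 XE CE dE T0 m0' cnt.
have x0 : 0 < x by nra.
have Qx : 0 < Q * x by nra.
have : Q * x * ((1 - Q^-1 + eta) * m) <= Q * x * d by rewrite ler_pM2l.
have -> : Q * x * ((1 - Q^-1 + eta) * m) = x * m * (Q - 1 + Q * eta) by field; apply: lt0r_neq0; lra.
move=> h; have h2 : x * m * Q * eta <= c * (Q * x) + m * t by lra.
have h3 : 2 * (m * t) <= Q * m * (x * eta).
  have : m * (2 * t) <= m * (x * eta) by rewrite ler_pM2l //; lra.
  have : 1 * (m * (x * eta)) <= Q * (m * (x * eta)).
    by rewrite ler_pM2r // !mulr_gt0.
  lra.
have : Q * x * (2 * c) < Q * x * (m * eta) by rewrite ltr_pM2l.
lra.
Qed.

(** One part is added at a time. The degree condition for a larger [q] implies that for a smaller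
    one, so induction supplies the parts that [blowup_extend] starts from; a single part is any set
    of the right size. *)
Lemma erdos_stone_min_degree (K : archiRealFieldType) q (eta : K) T : (0 < q)%N -> 0 < eta ->
  exists m0 : nat, forall (V : finType) (e : rel V), simple e ->
    (m0 <= #|V|)%N ->
    (forall v, (1 - q%:R^-1 + eta) * #|V|%:R <= #|nbr e v|%:R) ->
    has_blowup e q.+1 T.
Proof.
case: q => // q _ eta0; elim: q T => [|q IHq] T.
  have [T' [m0 mP]] := blowup_extend T (ltn0Sn 0) eta0.
  exists (maxn m0 T') => V e eS; rewrite geq_max => /andP[m0V TV] degP.
  apply: mP => //; have [|B [_ BT]] := @exists_subset_card V setT T'; first by rewrite cardsT.
  by exists (fun=> B); split=> // i j; rewrite (ord1 i) (ord1 j).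
have [T' [m0 mP]] := blowup_extend T (ltn0Sn q.+1) eta0.
have [m1 m1P] := IHq T'.
exists (maxn m0 m1) => V e eS; rewrite geq_max => /andP[m0V m1V] degP.
apply: mP => //; apply: m1P => // v; apply: le_trans (degP v).
rewrite ler_wpM2r // lerD2r lerD2l lerN2 lef_pV2 ?posrE ?ltr0n //.
by rewrite ler_nat.
Qed.

(** * Growth of the extremal number *)

Section Clone.
Variables (F : graph) (V : finType) (e : rel V) (B : {set V}).
Hypotheses (eS : simple e) (nF : ~ embeds F e).
Hypotheses (BF : #|B| = #|vertex F|) (F0 : (0 < #|vertex F|)%N).

Let N : {set V} := [set v | [forall b in B, e b v]].

Definition clone_rel : rel (option V) := fun x y =>
  match x, y with
  | Some a, Some b => e a b
  | Some a, None | None, Some a => a \in N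
  | None, None => false
  end.

Lemma clone_simple : simple clone_rel.
Proof. by split=> [[a|] [b|]|[a|]] //=; rewrite ?eS.2 // eS.1. Qed.

Lemma clone_free : ~ embeds F clone_rel.
Proof.
case=> g [gI gH].
(* If the copy uses the new vertex, its other [#|vertex F| - 1] vertices cannot cover [B], and a
   missed [b] replaces the new vertex. Otherwise [b] is any element of [B], serving as the default
   of [odflt]. *)
have [b bP] : exists b, None \in codom g -> b \in B /\ Some b \notin codom g.
  have [/codomP[w0 w0E] | nN] := boolP (None \in codom g); last first.
    have [b bB] : exists b, b \in B by apply/card_gt0P; rewrite BF.
    by exists b.
  have : ~~ (Some @: B \subset [set g w | w in [set~ w0]]).
    apply/negP => /subset_leq_card.
    rewrite (card_imset _ gI) (card_imset _ (@Some_inj _)) BF cardsC1.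
    by move: F0; lia.
  case/subsetPn=> _ /imsetP[b bB ->] bN; exists b => _; split=> //.
  apply: contra bN => /codomP[w wE]; rewrite wE imset_f // !inE.
  by apply/eqP=> ww; rewrite ww -w0E in wE.
apply: nF; exists (fun w => odflt b (g w)); split=> [w w' | w w' /gH].
  case gw: (g w) => [v|] /=; case gw': (g w') => [v'|] /= vE.
  - by apply: gI; rewrite gw gw' vE.
  - have [|_ /negP[]] := bP; first by rewrite -gw' codom_f.
    by rewrite -vE -gw codom_f.
  - have [|_ /negP[]] := bP; first by rewrite -gw codom_f.
    by rewrite vE -gw' codom_f.
  by apply: gI; rewrite gw gw'.
case gw: (g w) => [v|] /=; case gw': (g w') => [v'|] //= h.
- have [|bB _] := bP; first by rewrite -gw' codom_f.
  by rewrite eS.1; move: h; rewrite inE => /forall_inP; apply.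
have [|bB _] := bP; first by rewrite -gw codom_f.
by move: h; rewrite inE => /forall_inP; apply.
Qed.

Lemma arcs_clone_le_ex :
  (arcs e setT + 2 * #|N| <= 2 * ex #|V|.+1 (family1 F))%N.
Proof.
have := arcs_le_ex clone_simple clone_free; rewrite card_option.
apply: leq_trans; rewrite (arcsD1 clone_simple (in_setT None)) setIT leq_add //.
  have -> : [set: option V] :\ None = Some @: [set: V].
    apply/setP=> -[v|]; rewrite !inE; first by rewrite imset_f ?inE.
    by apply/esym/negP=> /imsetP[].
  rewrite /arcs big_imset /=; last exact: in2W Some_inj.
  apply: leq_sum => v _.
  rewrite -(card_imset _ (@Some_inj _)) subset_leq_card //; apply/subsetP=> _ /imsetP[a + ->].
  by rewrite !inE andbT => ea; rewrite /= ea imset_f ?inE.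
rewrite leq_mul2l -(card_imset _ (@Some_inj _)) subset_leq_card //.
by apply/subsetP=> _ /imsetP[a aN ->]; rewrite inE.
Qed.
End Clone.

(** * Turan-type bounds on the extremal number *)

Section Asymptotics.
Variables (K : archiRealFieldType) (F : graph) (r : nat).
Hypotheses (r0 : (0 < r)%N) (Fr : ~~ colorable F r).
Notation x m := (ex m (family1 F)).

Lemma vertex_gt0 : (0 < #|vertex F|)%N.
Proof.
rewrite lt0n; apply: contra Fr => /eqP F0; apply/existsP.
exists [ffun=> Ordinal r0]; apply/forallP=> w.
by have := fintype0 w F0.
Qed.

Lemma not_embeds_empty (V : finType) : ~ embeds F (fun _ _ : V => false).
Proof.
case=> g [_ gH]; case/negP: Fr; apply/existsP; exists [ffun=> Ordinal r0].
by apply/forallP=> v; apply/forallP=> w; apply/implyP => /gH.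
Qed.

Lemma card_residue_class m c : (#|[set y : 'I_m | y %% r == c]| <= (m %/ r).+1)%N.
Proof.
pose h (y : 'I_m) : 'I_(m %/ r).+1 := inord (y %/ r).
have hE y : h y = (y %/ r)%N :> nat.
  by rewrite inordK // ltnS leq_div2r // ltnW.
rewrite -[X in (_ <= X)%N](card_ord (m %/ r).+1).
rewrite -(@card_in_imset _ _ h) ?max_card // => y z.
rewrite !inE => /eqP yc /eqP zc /(congr1 val) /=; rewrite !hE => yz.
by apply: val_inj; rewrite /= (divn_eq y r) (divn_eq z r) yc zc yz.
Qed.

(** The witness is the complete [r]-partite graph on the residue classes modulo [r]. A copy of [F]
    would be coloured by residues, and a vertex has at most [m %/ r + 1] non-neighbours, itself
    included. *)
Lemma turan_lower_bound m :
  (1 - r%:R^-1) * m%:R ^+ 2 - m%:R <= 2 * (x m)%:R :> K.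
Proof.
pose e : rel 'I_m := fun y z => (y %% r != z %% r)%N.
have eS : simple e by split=> [y z|y]; rewrite /e ?eqxx // eq_sym.
have nF : ~ embeds F e.
  case=> g [_ gH]; case/negP: Fr; apply/existsP.
  exists [ffun w => Ordinal (ltn_pmod (g w) r0)].
  apply/forallP=> v; apply/forallP=> w; apply/implyP => /gH.
  by rewrite !ffunE -val_eqE.
have := arcs_le_ex eS nF; rewrite card_ord => /(leq_mul (leqnn r)).
have : (m * (r * m) <= r * arcs e setT + m * (m + r))%N.
  have cm : #|[set: 'I_m]| = m by rewrite cardsT card_ord.
  rewrite /arcs big_distrr /= -[X in (X * _)%N]cm.
  rewrite -[X in (_ <= _ + X * _)%N]cm -!sum_nat_const.
  rewrite -big_split /=; apply: leq_sum => y _; rewrite setIT.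
  have := card_residue_class m (y %% r)%N.
  have := cardsC (nbr e y); rewrite card_ord.
  have -> : ~: nbr e y = [set z : 'I_m | (z %% r == y %% r)%N].
    by apply/setP=> z; rewrite !inE negbK eq_sym.
  have := leq_trunc_div m r; move: (#|_|) (#|_|) (m %/ r)%N => p p' k.
  move=> h h' /(leq_mul (leqnn r)); rewrite mulnS.
  have : (r * m = r * p + r * p')%N by rewrite -mulnDr; congr muln; lia.
  lia.
rewrite -!(ler_nat K) !(natrD, natrM) => h1 h2.
have r1 : 0 < r%:R :> K by rewrite ltr0n.
rewrite -(ler_pM2l r1); move: h1 h2 r1.
move: (r%:R : K) (m%:R : K) ((x m)%:R : K) ((arcs e setT)%:R : K) => R M X A h1 h2 R0.
have -> : R * ((1 - R^-1) * M ^+ 2 - M) = M * (R * M) - M * M - R * M by field; apply: lt0r_neq0.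
lra.
Qed.

Hypothesis Fr1 : colorable F r.+1.

(** Deleting a vertex of an extremal graph on [m.+1] vertices leaves an [F]-free graph, so every
    degree is at least the increment. A larger increment would thus force a complete [r.+1]-partite
    graph containing [F]. *)
Lemma ex_increment_le (eta : K) : 0 < eta -> exists m0 : nat, forall m, (m0 <= m)%N ->
  (x m.+1)%:R <= (x m)%:R + (1 - r%:R^-1 + eta) * m.+1%:R :> K.
Proof.
move=> eta0; have [m0 m0P] := erdos_stone_min_degree #|vertex F| r0 eta0.
exists m0 => m m0m; have [e [eS nF eE]] := ex_attained (@not_embeds_empty 'I_m.+1).
apply: contrapT => /negP; rewrite -ltNge => lt; apply: (nF).
apply: (blowup_embeds eS.2 Fr1); apply: m0P => // [|v]; rewrite card_ord ?leqW //.
have := arcsD1 eS (in_setT v); rewrite setIT eE => eD.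
have := arcs_in_le_ex ([set: 'I_m.+1] :\ v) eS nF.
have -> : #|[set: 'I_m.+1] :\ v| = m.
  by have := cardsD1 v [set: 'I_m.+1]; rewrite in_setT cardsT card_ord => -[].
move=> h; have : (x m.+1 <= x m + #|nbr e v|)%N.
  by rewrite -(leq_pmul2l (ltn0Sn 1)) eD mulnDr leq_add2r.
rewrite -(ler_nat K) natrD; lra.
Qed.

Lemma ex_upper_bound (eta : K) : 0 < eta -> exists C : nat, forall m,
  2 * (x m)%:R <= (1 - r%:R^-1 + eta) * (m%:R * (m%:R + 1)) + C%:R :> K.
Proof.
move=> eta0; have [m0 m0P] := ex_increment_le eta0.
(* This constant covers every [m <= m0]; beyond, the increments add up, since
   [(m + 1) * (m + 2) - m * (m + 1)] equals [2 * (m + 1)]. *)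
exists (\sum_(i < m0.+1) 2 * x i)%N => m.
have a0 : 0 <= 1 - r%:R^-1 + eta.
  have : r%:R^-1 <= 1 :> K by rewrite invf_le1 ?ltr0n // ler1n.
  lra.
have base k : (k <= m0)%N -> 2 * (x k)%:R <= (1 - r%:R^-1 + eta) * (k%:R * (k%:R + 1)) + 
    (\sum_(i < m0.+1) 2 * x i)%N%:R :> K.
  move=> km; rewrite -natrM (@le_trans _ _ (\sum_(i < m0.+1) 2 * x i)%N%:R) //.
    by rewrite ler_nat (bigD1 (Ordinal (km : (k < m0.+1)%N))) //= leq_addr.
  by rewrite lerDr !mulr_ge0 // addr_ge0.
have [mm|mm] := leqP m m0; first exact: base.
elim: m mm => // m IHm; rewrite ltnS leq_eqVlt => /predU1P[mE | mm].
  have := base m0 (leqnn _); have := m0P m0 (leqnn _); rewrite mE -natr1; lra.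
have := IHm mm; have := m0P m (ltnW mm); rewrite -natr1; lra.
Qed.
End Asymptotics.

(* [S] maximises [arcs e S - c * #|S| ^+ 2]. *)
Lemma dense_core (V : finType) (K : archiRealFieldType) (e : rel V) (c : K) : simple e ->
  exists S : {set V},
    (arcs e setT)%:R - c * #|V|%:R ^+ 2 <= (arcs e S)%:R - c * #|S|%:R ^+ 2 /\
    forall v, v \in S -> c * (2 * #|S|%:R - 1) <= 2 * #|nbr e v :&: S|%:R.
Proof.
move=> eS; pose phi (S : {set V}) : K := (arcs e S)%:R - c * #|S|%:R ^+ 2.
have [S _ SP] := @arg_maxP _ _ _ [set: V] predT phi isT.
exists S; split=> [|v vS]; first by have := SP setT isT; rewrite /phi cardsT.
have Sv : #|S| = #|S :\ v|.+1 by rewrite (cardsD1 v S) vS.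
have := SP (S :\ v) isT; rewrite /phi /= (arcsD1 eS vS) Sv natrD natrM -natr1; lra.
Qed.

(** Arithmetic for [large_core]: [M] and [k] are the orders of the graph and of its core, [a] the
    Turan density. The right side is about [1.01 * eps * k ^+ 2], and [1.01 * 0.99 ^+ 2 < 1] leaves
    no room for [k] below [0.99 * M]. *)
Lemma core_size_bound (K : realFieldType) (a eps M k c : K) :
    0 < eps -> 0 <= a <= 1 -> 1 <= M -> 0 <= k <= M -> 0 <= c ->
    1000 * (5 + eps + c) <= M * eps ->
    eps * M ^+ 2 - M <=
      (a + eps / 100) * (k * (k + 1)) + c - (a - eps) * k ^+ 2 ->
  99 * M <= 100 * k.
Proof.
move=> e0 /andP[a0 a1] M1 /andP[k0 kM] c0 big S1.
have M0 : 0 <= M := le_trans ler01 M1.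
rewrite leNgt; apply/negP => kM'.
have h1 : eps * M ^+ 2 - M <= (eps + eps / 100) * k ^+ 2 + (1 + eps) * M + c.
  have : (a + eps / 100) * k <= (1 + eps) * M by apply: ler_pM => //; clear -e0 a0 a1; lra.
  move: S1; clear; rewrite !expr2; lra.
have h2 : eps * k ^+ 2 <= eps * (9801 / 10000 * M ^+ 2).
  rewrite ler_pM2l // (_ : _ * _ = (99 / 100 * M) * (99 / 100 * M)); last by field.
  by rewrite expr2; apply: ler_pM => //; clear -kM'; lra.
have h3 := ler_wpM2r M0 big.
have h4 : c <= c * M := ler_peMr c0 M1.
have h5 : 0 <= eps * M := mulr_ge0 (ltW e0) M0.
by clear -h1 h2 h3 h4 h5 M1 c0; rewrite !expr2 in h1 h2; lra.
Qed.

(** After multiplication by [R * (400 * g * g)], the slack in the degree costs [g * M / R], hence at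
    most one [g * M]; the second one pays for the summand [g] on the left. *)
Lemma min_degree_slack (K : realFieldType) (R g M D : K) :
    1 <= R -> 1 <= g -> 0 <= M ->
    (1 - R^-1 - 2 * (800 * g * R ^+ 2)^-1) * M <= D ->
  M * ((R - 1) * (400 * g * g) + g) <= R * (400 * g * g) * D + 2 * (g * M).
Proof.
move=> R1 g1 M0 dP.
have Rp : 0 < R := lt_le_trans ltr01 R1; have R0 := lt0r_neq0 Rp.
have gp : 0 < g := lt_le_trans ltr01 g1; have g0 := lt0r_neq0 gp.
have RT : 0 <= R * (400 * g * g) by rewrite !mulr_ge0 // ltW.
have := ler_wpM2l RT dP.
have -> : R * (400 * g * g) * ((1 - R^-1 - 2 * (800 * g * R ^+ 2)^-1) * M) =
  M * (400 * g * g * (R - 1)) - g * M * R^-1 by field; rewrite R0.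
have : g * M * R^-1 <= g * M by rewrite ler_piMr ?mulr_ge0 ?invf_le1 // ltW.
by clear; lra.
Qed.

(** Consecutive Turan densities differ by more than [R^-1 ^+ 2], which leaves room for both error
    terms. Degrees slightly below the density for [R] thus still satisfy the Erdos-Stone condition
    for [R - 1]. *)
Lemma turan_density_gap (K : realFieldType) (R g : K) : 1 < R -> 1 <= g ->
  1 - (R - 1)^-1 + (2 * R ^+ 2)^-1 <= 1 - R^-1 - 2 * (800 * g * R ^+ 2)^-1.
Proof.
move=> R1 g1; have Rp : 0 < R := lt_trans ltr01 R1; have R0 := lt0r_neq0 Rp.
have gp : 0 < g := lt_le_trans ltr01 g1; have g0 := lt0r_neq0 gp.
have R1p : 0 < R - 1 by rewrite subr_gt0.
have R10 := lt0r_neq0 R1p.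
have -> : (R - 1)^-1 = R^-1 + R^-1 ^+ 2 + R^-1 ^+ 2 * (R - 1)^-1 by field; rewrite ?R0 ?R10 ?g0.
have -> : (2 * R ^+ 2)^-1 = R^-1 ^+ 2 / 2 by field.
have -> : (800 * g * R ^+ 2)^-1 = R^-1 ^+ 2 * g^-1 / 800 by field; rewrite ?R0 ?R10 ?g0.
have u0 : 0 < R^-1 ^+ 2 by rewrite exprn_gt0 // invr_gt0.
have w0 : 0 < R^-1 ^+ 2 * (R - 1)^-1 by rewrite mulr_gt0 // invr_gt0.
have : R^-1 ^+ 2 * g^-1 <= R^-1 ^+ 2 by rewrite ger_pMr // invf_le1.
by clear -u0 w0; lra.
Qed.

Section Growth.
Variables (K : archiRealFieldType) (F : graph) (r : nat).
Hypotheses (r2 : (2 < r)%N) (Fr : ~~ colorable F r) (Fr1 : colorable F r.+1).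
Notation x m := (ex m (family1 F)).
Let f := #|vertex F|.

Let r0 : (0 < r)%N. Proof. exact: leq_trans r2. Qed.

(** [dense_core] is used one [eps] below the Turan density. The Turan lower bound for the graph
    against the upper bound for the core forces the core to be large; the second [eps] absorbs the
    [- 1] in the degree bound of [dense_core]. *)
Lemma large_core (eps : K) : 0 < eps -> exists m1 : nat, forall m (e : rel 'I_m),
  (m1 <= m)%N -> simple e -> ~ embeds F e -> arcs e setT = (2 * x m)%N ->
  exists S : {set 'I_m}, (99 * m <= 100 * #|S|)%N /\
    forall v, v \in S -> (1 - r%:R^-1 - 2 * eps) * #|S|%:R <= #|nbr e v :&: S|%:R.
Proof.
move=> e0; have e1 : 0 < eps / 100 by rewrite divr_gt0.
have [C CP] := ex_upper_bound r0 Fr Fr1 e1.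
have [m1 m1P] := nat_upper_bound (1000 * (5 + eps + C%:R) / eps).
exists m1 => m e m1m eS nF eE.
have [S [S1 S2]] := dense_core (1 - r%:R^-1 - eps) eS.
have ri : 0 < (r%:R^-1 : K) <= 1 by rewrite invr_gt0 invf_le1 ltr0n r0 ?ler1n.
have SC := CP #|S|; have := turan_lower_bound K r0 Fr m.
have := arcs_in_le_ex S eS nF; rewrite -(ler_nat K) natrM => aS.
have Sm : #|S|%:R <= m%:R :> K by rewrite ler_nat -[m in (_ <= m)%N]card_ord max_card.
have mB : 1000 * (5 + eps + C%:R) <= m%:R * eps.
  by rewrite -ler_pdivrMr // (le_trans m1P) // ler_nat.
move: S1; rewrite eE natrM card_ord => S1 tl.
have M1 : 1000 < m%:R :> K.
  have : 0 <= C%:R :> K by [].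
  by rewrite -(ltr_pM2r e0); lra.
have k99 : 99 * m%:R <= 100 * #|S|%:R :> K.
  apply: (core_size_bound (a := 1 - r%:R^-1) e0 _ _ _ _ mB) => //.
  - by lra.
  - by lra.
  - by rewrite ler0n.
  by lra.
exists S; split=> [|v vS]; first by rewrite -(ler_nat K) !natrM.
have := S2 v vS.
have h1 : 5 * 99 <= eps * (100 * #|S|%:R).
  have : eps * (99 * m%:R) <= eps * (100 * #|S|%:R) by rewrite ler_pM2l.
  have : 0 <= C%:R :> K by [].
  by lra.
have h2 : 0 <= r%:R^-1 :> K by case/andP: ri => /ltW.
by lra.
Qed.

Lemma large_common_nbr : exists (eps : K) (k0 : nat), 0 < eps /\
  forall (V : finType) (e : rel V), simple e -> ~ embeds F e -> (k0 <= #|V|)%N ->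
    (forall v, (1 - r%:R^-1 - 2 * eps) * #|V|%:R <= #|nbr e v|%:R) ->
  exists B : {set V}, #|B| = f /\
    (64 * #|V| <= 100 * #|[set v | [forall b in B, e b v]]|)%N.
Proof.
have f0 : (0 < f)%N := vertex_gt0 r0 Fr.
have rr : 0 < r%:R :> K by rewrite ltr0n.
have ff : 0 < f%:R :> K by rewrite ltr0n.
pose eps : K := (800 * f%:R * r%:R ^+ 2)^-1.
pose eta : K := (2 * r%:R ^+ 2)^-1.
pose T := (400 * f * f)%N.
have eta0 : 0 < eta by rewrite invr_gt0 mulr_gt0 // exprn_gt0.
have eps0 : 0 < eps by rewrite invr_gt0 !mulr_gt0 // exprn_gt0.
have r1 : (0 < r.-1)%N by move: r2; lia.
have [k1 k1P] := erdos_stone_min_degree T r1 eta0.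
have [C CE] : exists C, C = (f * 2 ^ (r * T))%N by eexists.
exists eps, (maxn k1 (1200 * f * r * C.+1)); split=> // V e eS nF.
rewrite geq_max => /andP[kV CV] degP.
have [A bA] : has_blowup e r T.
  rewrite -(prednK r0); apply: k1P => // v; apply: le_trans (degP v).
  rewrite ler_wpM2r // /eta /eps.
  have -> : r.-1%:R = r%:R - 1 :> K by rewrite -subn1 natrB.
  by apply: turan_density_gap; rewrite ?ltr1n ?ler1n // ltnW.
have nB : ~ has_blowup e r.+1 f by move/(blowup_embeds eS.2 Fr1).
have V0 : (0 < #|V|)%N by rewrite (leq_trans _ CV) // !muln_gt0 f0 r0.
have [v0 v0P] := min_degree_attained e V0.
(* With this [L], the missing vertices of the [f] elements of [B] number at most [#|V| / 50]. *)
pose L := (#|V| %/ (50 * f))%N.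
have L1 : (#|V| < L.+1 * (50 * f))%N by rewrite ltn_ceil // muln_gt0.
have L2 : (L * (50 * f) <= #|V|)%N by apply: leq_trunc_div.
(* The product [L.+1 * (T.+1 - f)] exceeds [4 * f * #|V|], while the term in [C] costs at most
   [f * #|V|] and the degree slack at most [2 * f * #|V|]. *)
have fL : (C * (r * T) + #|V| * (r.-1 * T + f) < r * T * #|nbr e v0| + L.+1 * (T.+1 - f))%N.
  have fT : (2 * f <= T)%N by rewrite /T; nia.
  have dP := degP v0.
  have P2 : (T <= 2 * (T.+1 - f))%N by lia.
  have RC : (1200 * f * r * C <= #|V|)%N by rewrite (leq_trans _ CV) // leq_mul2l leqnSn orbT.
  move: (T.+1 - f)%N (#|nbr e v0|) (L.+1) (#|V|) V0 dP P2 L1 RC => P d L' m m0 dP P2 L1 RC.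
  have rE : r.-1%:R = r%:R - 1 :> K by rewrite -subn1 natrB.
  have fg : (4 * f * m < L' * P)%N.
    have : (m * (400 * f * f) < L' * (50 * f) * (2 * P))%N.
      apply: (@leq_trans (L' * (50 * f) * (400 * f * f))%N); last by rewrite leq_mul2l P2 orbT.
      by rewrite ltn_pmul2r // !muln_gt0 f0.
    have -> : (m * (400 * f * f) = (100 * f) * (4 * f * m))%N by ring.
    have -> : (L' * (50 * f) * (2 * P) = (100 * f) * (L' * P))%N by ring.
    by rewrite ltn_pmul2l // muln_gt0.
  have RC' : (C * (r * T) <= f * m)%N.
    rewrite /T; have : (f * (1200 * f * r * C) <= f * m)%N by rewrite leq_mul2l RC orbT.
    by apply: leq_trans; rewrite [leqRHS](_ : _ = 3 * (C * (r * (400 * f * f))))%N; [lia | ring].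
  suff : (m * (r.-1 * T + f) <= r * T * d + 2 * (f * m))%N by lia.
  rewrite -(ler_nat K) !(natrD, natrM) rE /T ?natrM.
  by apply: min_degree_slack; rewrite ?ler1n ?ler0n.
rewrite CE in fL; have [B [BE]] := blowup_common_nbr eS bA nB r0 v0P fL.
rewrite -CE => BP; exists B; split=> //.
(* As [r] is at least 3, the vertices not short on the chosen part make up about 2/3 of all; the
   losses are at most 1/50 and 1/1200, which leaves more than 0.64. *)
have h1 : (2 * #|V| <= 3 * (C + f * L + #|[set v | [forall b in B, e b v]]|))%N.
  move: BP; move: (C + _ + _)%N (#|V|) => Z m BP.
  have rm : (3 * m <= r * m)%N by rewrite leq_mul2r r2 orbT.
  by rewrite -(leq_pmul2l r0); move: BP rm; clear; lia.
have h2 : (C <= f * r * C.+1)%N.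
  by apply: leq_trans (leqnSn C) _; rewrite leq_pmull // muln_gt0 f0.
move: CV L2 h1 h2; move: (L) (#|V|) (#|_|); clear => L m N CV L2 h1 h2.
by lia.
Qed.

(** The set [B] is found in the core, but the new vertex is added to the whole extremal graph. It
    gains at least [0.64 * 0.99 * m] edges, more than [3 * m / 5]. *)
Lemma ex_growth : exists m1 : nat, forall m, (m1 <= m)%N ->
  (5 * x m + 3 * m <= 5 * x m.+1)%N.
Proof.
have [eps [k0 [eps0 commonP]]] := large_common_nbr.
have [m1 coreP] := large_core eps0.
exists (maxn m1 (2 * k0)) => m; rewrite geq_max => /andP[m1m km].
have [e [eS nF eE]] := ex_attained (@not_embeds_empty F r r0 Fr 'I_m).
have [S [Sm SP]] := coreP m e m1m eS nF eE.
pose e' : rel {v | v \in S} := relpre val e.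
have e'S : simple e' by split=> [a b|a]; rewrite /e' /= ?eS.2 // eS.1.
have cS : #|{: {v | v \in S}}| = #|S| by rewrite card_sig.
have [||v|B [BE BN]] := commonP _ e' e'S.
- by move/(embeds_relpre val_inj).
- by rewrite cS; lia.
- by rewrite cS card_nbr_sub; apply: SP; apply: (valP v).
have B'E : #|val @: B| = f by rewrite card_imset ?BE //; apply: val_inj.
have := arcs_clone_le_ex eS nF B'E (vertex_gt0 r0 Fr).
rewrite eE card_ord; set N := [set v | _]; set N' := [set v | _] in BN.
have : (#|N'| <= #|N|)%N.
  rewrite -(card_imset _ val_inj) subset_leq_card //; apply/subsetP=> _ /imsetP[v vN ->].
  rewrite inE; apply/forall_inP => _ /imsetP[b bB ->].
  by move: vN; rewrite inE => /forall_inP; apply.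
move: BN; rewrite cS; lia.
Qed.
End Growth.

Local Close Scope ring_scope.

(** * Matchings *)

(** An arc not inside the complement of [D] starts or ends in [D], and the degree sum over [D]
    counts the arcs of either kind. *)
Lemma arcs_delete (V : finType) (e : rel V) (D : {set V}) : simple e ->
  arcs e setT <= arcs e (~: D) + 2 * \sum_(v in D) #|nbr e v|.
Proof.
move=> eS; rewrite /arcs (eq_bigl predT) => [|v]; last by rewrite inE.
rewrite (bigID (mem D)) /= mul2n -addnn addnA [X in _ <= X]addnC.
apply: leq_add; first by apply: leq_sum => v _; rewrite setIT.
have -> : \sum_(v in D) #|nbr e v| = \sum_v #|nbr e v :&: D|.
  under [RHS]eq_bigr do rewrite -sum1_card.
  rewrite (exchange_big_dep (mem D)) /= => [|v w _]; last by rewrite inE => /andP[].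
  apply: eq_bigr => v vD; rewrite -sum1_card; apply: eq_bigl => w.
  by rewrite !inE vD andbT eS.1.
apply: (@leq_trans (\sum_(v in ~: D) (#|nbr e v :&: ~: D| + #|nbr e v :&: D|))).
  rewrite [leqRHS](eq_bigl (fun v => v \notin D)) => [|v]; last by rewrite inE.
  by apply: leq_sum => v _; rewrite setIT -(cardsID D) addnC setDE.
rewrite big_split /= leq_add2l [leqRHS](bigID (mem (~: D))) /=.
exact: leq_addr.
Qed.

(* A matching is an involution moving vertices along edges; its fixed points are
   the uncovered vertices. *)
Definition is_matching (V : finType) (e : rel V) (g : {ffun V -> V}) :=
  [forall x, (g (g x) == x) && ((g x != x) ==> e x (g x))].

Definition covered (V : finType) (g : {ffun V -> V}) : {set V} :=
  [set x | g x != x].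

Section Matching.
Variables (V : finType) (e : rel V).
Hypothesis eS : simple e.
Implicit Types g : {ffun V -> V}.

Lemma is_matchingP g :
  reflect (involutive g /\ forall x, g x != x -> e x (g x)) (is_matching e g).
Proof.
apply: (iffP forallP) => [h | [gK ge] x].
  by split=> [x|x]; case/andP: (h x) => /eqP// _ /implyP.
by rewrite gK eqxx; apply/implyP/ge.
Qed.

Lemma covered_le g s : is_matching e g -> ~ embeds (matching s.+1) e ->
  #|covered g| <= 2 * s.
Proof.
(* [A] selects the end of smaller rank of each matching edge, so its size is the number of edges. *)
move=> /is_matchingP[gK ge] nM; pose A := [set x | enum_rank x < enum_rank (g x)].
have cA : covered g \subset A :|: g @: A.
  apply/subsetP=> x; rewrite inE => gx; rewrite !inE.
  case: ltngtP => //= [lt | /ord_inj/enum_rank_inj eq]; last by rewrite -eq eqxx in gx.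
  by apply/imsetP; exists (g x); rewrite ?inE gK.
suff As : #|A| <= s.
  rewrite (leq_trans (subset_leq_card cA)) // (leq_trans (leq_card_setU _ _)) //.
  by rewrite mul2n -addnn leq_add // (leq_trans (leq_imset_card _ _)).
rewrite leqNgt; apply/negP => sA; apply: nM.
pose a (i : 'I_s.+1) := enum_val (widen_ord sA i).
have aA i : enum_rank (a i) < enum_rank (g (a i)).
  by have := enum_valP (widen_ord sA i); rewrite inE.
have aI : injective a by move=> i j /enum_val_inj/(congr1 val)/= /val_inj.
have ga i j : a i <> g (a j).
  move=> aij; have := aA i; have := aA j; rewrite aij gK => h1 h2.
  by have := ltn_trans h1 h2; rewrite ltnn.
exists (fun p : 'I_s.+1 * bool => if p.2 then g (a p.1) else a p.1); split.
  move=> [i []] [j []] //= h.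
  - by rewrite (aI _ _ (can_inj gK h)).
  - by case: (ga j i).
  - by case: (ga i j).
  by rewrite (aI _ _ h).
have gae i : e (a i) (g (a i)).
  by apply: ge; apply/eqP=> h; have := ga i i; rewrite h.
move=> p q pq; move: (adjacent_neq pq) => npq.
case/imsetP: pq => i _ E; have := set21 p q; have := set22 p q; rewrite E !inE.
move=> /orP[]/eqP qE /orP[]/eqP pE; move: npq; rewrite pE qE ?eqxx //=.
by rewrite eS.1.
Qed.

(* Adds the edge [uv] and drops the matching edges at [u] and [v]. *)
Definition rematch g u v : {ffun V -> V} :=
  [ffun z => if z == u then v else if z == v then u
             else if (g z == u) || (g z == v) then z else g z].

Lemma rematch_matching g u v : is_matching e g -> e u v ->
  is_matching e (rematch g u v).
Proof.
move=> /is_matchingP[gK ge] uv.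
have nuv : u != v by apply: contraTneq uv => ->; rewrite eS.2.
apply/is_matchingP; split=> z; rewrite !ffunE.
  have [->|zu] := eqVneq z u; first by rewrite eq_sym (negPf nuv) eqxx.
  have [->|zv] := eqVneq z v; first by rewrite eqxx.
  have [h|] := boolP ((g z == u) || (g z == v)); first by rewrite (negPf zu) (negPf zv) h.
  rewrite negb_or => /andP[/negPf-> /negPf->]; by rewrite gK (negPf zu) (negPf zv).
have [->|zu] := eqVneq z u; first by [].
have [->|zv] := eqVneq z v; first by rewrite eS.1.
by case: ifP => _; [rewrite eqxx | apply: ge].
Qed.

Lemma covered_rematch g u v : involutive g -> u != v ->
  covered (rematch g u v) = (covered g :\: [set g u; g v]) :|: [set u; v].
Proof.
move=> gK nuv; apply/setP=> z; rewrite !inE !ffunE -![z == g _](can2_eq gK gK).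
have [->|zu] := eqVneq z u; first by rewrite eq_sym nuv !orbT.
have [->|zv] := eqVneq z v; first by rewrite nuv !orbT.
by rewrite !orbF; case: ifP => // _; rewrite eqxx.
Qed.

Definition extremal_matching (D : {set V}) g :=
  [/\ is_matching e g,
      forall g', is_matching e g' -> #|covered g'| <= #|covered g| &
      forall g', is_matching e g' -> #|covered g'| = #|covered g| ->
        #|covered g' :&: D| <= #|covered g :&: D|].

Lemma exists_extremal_matching D : exists g, extremal_matching D g.
Proof.
have id_m : is_matching e [ffun z => z].
  by apply/is_matchingP; split=> z; rewrite !ffunE ?eqxx.
have [g0 g0m g0max] := arg_maxnP (fun g => #|covered g|) id_m.
pose P g := is_matching e g && (#|covered g| == #|covered g0|).
have P0 : P g0 by rewrite /P eqxx andbT.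
have [g /andP[gm /eqP gE] gmax] := @arg_maxnP _ g0 P (fun g => #|covered g :&: D|) P0.
exists g; split=> // g' g'm; first by rewrite gE; apply: g0max.
by rewrite gE => g'E; apply: gmax; rewrite /P g'm g'E eqxx.
Qed.

Section Extremal.
Variables (D : {set V}) (g : {ffun V -> V}).
Hypothesis gX : extremal_matching D g.

Let gm : is_matching e g. Proof. by case: gX. Qed.
Let gK : involutive g. Proof. by case/is_matchingP: gm. Qed.

Lemma uncovered_nonadjacent u v : g u = u -> g v = v -> ~~ e u v.
Proof.
move=> gu gv; apply/negP=> uv.
have nuv : u != v by apply: contraTneq uv => ->; rewrite eS.2.
have [_ /(_ _ (rematch_matching gm uv)) + _] := gX.
rewrite leqNgt => /negP[]; apply: proper_card.
rewrite covered_rematch // gu gv; apply/properP; split.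
  apply/subsetP=> z; rewrite !inE => gz; rewrite gz andbT.
  by case: (z == u); case: (z == v).
by exists u; rewrite !inE ?eqxx ?gu ?eqxx ?orbT.
Qed.

(** Otherwise [u], [x], [g x], [v] is an augmenting path: rematching [u] with [x] frees [g x], which
    is then matched to [v], and two more vertices are covered. *)
Lemma uncovered_no_augmentation u v x : u != v -> g u = u -> g v = v ->
  e u x -> ~~ e v (g x).
Proof.
move=> nuv gu gv ux; apply/negP=> vy.
have nux : u != x by apply: contraTneq ux => ->; rewrite eS.2.
have xv : x != v by apply: contraTneq ux => ->; apply: uncovered_nonadjacent.
have gxu : g x != u by rewrite (can2_eq gK gK) gu eq_sym.
have gxv : g x != v by rewrite (can2_eq gK gK) gv.
have gx : g x != x by apply: contraTneq ux => gx; apply: uncovered_nonadjacent.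
pose g1 := rematch g u x.
have g1m : is_matching e g1 by apply: rematch_matching.
have g1K : involutive g1 by case/is_matchingP: g1m.
have g1v : g1 v = v by rewrite !ffunE gv !(eq_sym v) (negPf xv) (negPf nuv).
have g1y : g1 (g x) = g x by rewrite !ffunE (negPf gxu) (negPf gx) gK eqxx orbT.
have [_ /(_ _ (rematch_matching g1m vy)) + _] := gX.
rewrite leqNgt => /negP[]; apply: proper_card.
rewrite covered_rematch 1?eq_sym // g1v g1y covered_rematch // gu.
apply/properP; split.
  apply/subsetP=> z; rewrite !inE => gz; rewrite gz !andbT.
  by case: (z == u); case: (z == v); case: (z == x); case: (z == g x).
by exists u; rewrite !inE ?gu ?eqxx // (negPf nuv) (eq_sym u) (negPf gxu) orbT.
Qed.

(** If neither [y] nor [g y] were in [D], replacing the edge from [y] to [g y] by the one from [x]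
    to [y] would keep the size and cover one more vertex of [D]. *)
Lemma uncovered_D_nbr x y : x \in D -> g x = x -> e x y ->
  y \in (covered g :&: D) :|: g @: (covered g :&: D).
Proof.
move=> xD gx xy.
have nxy : x != y by apply: contraTneq xy => ->; rewrite eS.2.
have gy : g y != y by apply: contraTneq xy => gy; apply: uncovered_nonadjacent.
rewrite in_setU [y \in _ :&: _]inE inE gy /=.
have [//|yD] := boolP (y \in D).
have [gyD|gyD] := boolP (g y \in D).
  by apply/imsetP; exists (g y); rewrite ?gK // !inE gK eq_sym gy.
have [_ _ /(_ _ (rematch_matching gm xy))] := gX.
have gyx : g y != x by rewrite (can2_eq gK gK) gx eq_sym.
have E : covered (rematch g x y) = x |: covered g :\ g y.
  rewrite covered_rematch // gx; apply/setP=> z; rewrite !inE.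
  have [->|zx] := eqVneq z x; first by rewrite orbT.
  have [->|zy] := eqVneq z y; first by rewrite gy eq_sym gy !orbT.
  by rewrite !orbF.
rewrite E cardsU1 !inE gx eqxx andbF /= => h.
have gyc : g y \in covered g by rewrite inE gK eq_sym.
have /h : 1 + #|covered g :\ g y| = #|covered g| by rewrite [RHS](cardsD1 (g y)) gyc.
have -> : (x |: covered g :\ g y) :&: D = x |: (covered g :&: D).
  apply/setP=> z; rewrite !inE; have [->|zx] := eqVneq z x; first by rewrite xD.
  by have [->|//] := eqVneq z (g y); rewrite (negPf gyD) !andbF.
by rewrite cardsU1 !inE gx eqxx ltnn.
Qed.

(** For two such vertices [u] and [v], the sets [g @: nbr e u] and [nbr e v] are disjoint by
    [uncovered_no_augmentation], yet their sizes add up to more than [#|V|]. *)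
Lemma uncovered_outside_le1 : (forall v, v \notin D -> #|V| < 2 * #|nbr e v|) ->
  #|~: covered g :\: D| <= 1.
Proof.
move=> deg; rewrite leqNgt; apply/negP=> /card_gt1P[u [v []]].
rewrite !inE !negbK => /andP[uD /eqP gu] /andP[vD /eqP gv] nuv.
have : #|g @: nbr e u :|: nbr e v| <= #|V| by apply: max_card.
have -> : #|g @: nbr e u :|: nbr e v| = #|nbr e u| + #|nbr e v|.
  rewrite cardsU card_imset; last exact: (can_inj gK).
  rewrite (_ : _ :&: _ = set0) ?cards0 ?subn0 //; apply/setP=> y.
  rewrite in_setI in_set0; apply/negP=> /andP[/imsetP[x]]; rewrite !inE => ux ->.
  exact/negP/(uncovered_no_augmentation nuv gu gv ux).
have := deg _ uD; have := deg _ vD; lia.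
Qed.
End Extremal.
End Matching.

(** [P] is the covered part of [D]. At least [#|V| - 2 * s] vertices are uncovered and at most one
    of them is outside [D], which bounds [#|P|]; an uncovered vertex of [D] has degree at most
    [2 * #|P|]. *)
Lemma edges_touching_le (V : finType) (e : rel V) (D : {set V}) s :
    simple e -> ~ embeds (matching s.+1) e ->
    (forall v, v \notin D -> #|V| < 2 * #|nbr e v|) ->
  exists P : {set V}, [/\ P \subset D, #|P| + #|V| <= 2 * s + 1 + #|D| &
    \sum_(v in D) #|nbr e v| <= \sum_(v in P) #|nbr e v| + 2 * #|P| * #|D|].
Proof.
move=> eS nM deg; have [g gX] := exists_extremal_matching e D.
exists (covered g :&: D); rewrite subsetIr; split=> //.
  have := uncovered_outside_le1 eS gX deg.
  have [gm _ _] := gX; have := covered_le eS gm nM.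
  have := cardsID D (~: covered g); have := cardsC (covered g).
  have := cardsID (covered g) D; rewrite [D :&: _]setIC.
  by rewrite [~: _ :&: D]setIC -setDE; lia.
rewrite (big_setID (covered g)) /= [D :&: _]setIC leq_add2l.
apply: (@leq_trans (\sum_(v in D :\: covered g) 2 * #|covered g :&: D|)).
  apply: leq_sum => v; rewrite !inE negbK => /andP[/eqP gv vD].
  apply: (@leq_trans #|(covered g :&: D) :|: g @: (covered g :&: D)|).
    apply/subset_leq_card/subsetP=> y; rewrite inE => vy.
    exact: uncovered_D_nbr vy.
  rewrite (leq_trans (leq_card_setU _ _)) // mul2n -addnn leq_add2l.
  exact: leq_imset_card.
by rewrite sum_nat_const mulnC leq_mul2l subset_leq_card ?subsetDl ?orbT.
Qed.

(** * The extremal number with bounded matching number *)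

(** Serves to move the isolated vertices of a copy of [F] back into a smaller vertex set. The
    complement of [P] is no larger than that of its image, so their enumerations can be matched. *)
Lemma extend_injection (W U : finType) (P : {set W}) (h : W -> U) :
  {in P &, injective h} -> #|W| <= #|U| ->
  exists k : W -> U, injective k /\ {in P, k =1 h}.
Proof.
move=> hI WU; pose A := ~: P; pose B := ~: (h @: P).
have AB : #|A| <= #|B|.
  have := cardsC P; have := cardsC (h @: P); rewrite card_in_imset // /A /B; lia.
have rk w (wA : w \in A) : enum_rank_in wA w < #|B| by rewrite (leq_trans _ AB).
pose k w := if (insub w : option {w | w \in A}) is Some w' then enum_val (Ordinal (rk (val w') (valP w'))) else h w.
have kP : {in P, k =1 h} by move=> w wP; rewrite /k insubN // inE negbK.
have kA w : w \notin P -> exists wA : w \in A, k w = enum_val (Ordinal (rk w wA)).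
  move=> wP; have wA : w \in A by rewrite inE.
  rewrite /k; case: insubP => [w' _ <-|]; last by move/negP.
  by exists (valP w').
have kB w : w \notin P -> k w \notin h @: P.
  by move=> /kA[wA ->]; have := enum_valP (Ordinal (rk w wA)); rewrite inE.
exists k; split=> // v w; have [vP|vP] := boolP (v \in P); have [wP|wP] := boolP (w \in P).
- by rewrite !kP //; apply: hI.
- by move=> E; have := kB w wP; rewrite -E kP // imset_f.
- by move=> E; have := kB v vP; rewrite E kP // imset_f.
have [vA ->] := kA v vP; have [wA ->] := kA w wP.
move/enum_val_inj => [] /val_inj E.
by rewrite -(enum_rankK_in vA vA) E enum_rankK_in.
Qed.

Lemma arcs_relpre_le (U V : finType) (i : U -> V) (e : rel V) : injective i ->
  arcs (relpre i e) setT <= arcs e setT.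
Proof.
move=> iI; rewrite /arcs [leqRHS](bigID (mem (i @: setT))) /=.
rewrite (leq_trans _ (leq_addr _ _)) //.
rewrite [leqRHS](eq_bigl (mem (i @: setT))) => [|v]; last by rewrite inE.
rewrite big_imset /=; last exact: in2W.
apply: leq_sum => u _; rewrite !setIT -(card_imset _ iI) subset_leq_card //.
by apply/subsetP=> _ /imsetP[v + ->]; rewrite !inE.
Qed.

Lemma matching_partner k (p : 'I_k * bool) :
  adjacent (matching k) p (p.1, ~~ p.2).
Proof.
apply/imsetP; exists p.1 => //.
by case: p => i [] //=; rewrite setUC.
Qed.

Definition widen_rel m n (e : rel 'I_m) : rel 'I_n := fun a b =>
  match insub (val a), insub (val b) with
  | Some a', Some b' => e a' b'
  | _, _ => false
  end.

Section LowerBound.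
Variables (F : graph) (r s n : nat).
Hypotheses (r0 : 0 < r) (Fr : ~~ colorable F r).
Hypotheses (sn : 2 * s + 1 <= n) (Fs : #|vertex F| <= 2 * s + 1).

(** An extremal graph on [2 * s + 1] vertices is padded with isolated ones. A matching avoids the
    padding, so it has at most [s] edges; a copy of [F] meets the padding only in isolated vertices
    of [F], which can be relocated. *)
Lemma ex_ge_family2 :
  ex (2 * s + 1) (family1 F) <= ex n (family2 F (matching s.+1)).
Proof.
have [e [eS nF eE]] := ex_attained (@not_embeds_empty F r r0 Fr 'I_(2 * s + 1)).
pose e' : rel 'I_n := widen_rel e.
have e'S : simple e'.
  split=> [a b | a]; rewrite /e' /widen_rel; last by case: insubP => // u _ _; rewrite eS.2.
  by case: insubP => [u _ _|_]; case: insubP => [v _ _|_] //; rewrite eS.1.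
have m0 : 0 < 2 * s + 1 by rewrite addn1.
pose pr (a : 'I_n) : 'I_(2 * s + 1) := insubd (Ordinal m0) (val a).
have prE (a : 'I_n) : a < 2 * s + 1 -> val (pr a) = val a by move=> h; rewrite /pr val_insubd h.
have e'P a b : e' a b -> [/\ a < 2 * s + 1, b < 2 * s + 1 & e (pr a) (pr b)].
  rewrite /e' /widen_rel /pr /insubd.
  by case: insubP => // u -> _; case: insubP => // v -> _.
have e'w : relpre (widen_ord sn) e' =2 e.
  by move=> a b; rewrite /= /e' /widen_rel /= !valK.
pose G := graph_of_rel e'S.
have GE : adjacent G =2 e' by apply: adjacent_graph_of_rel.
have GF : ~ embeds F (adjacent G).
  case=> g [gI gH]; apply: nF; pose P := [set w | g w < 2 * s + 1].
  have hI : {in P &, injective (pr \o g)}.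
    move=> v w; rewrite !inE => vP wP /(congr1 val); rewrite /= !prE // => E.
    by apply: gI; apply: val_inj.
  have [|k [kI kP]] := extend_injection hI; first by rewrite card_ord.
  exists k; split=> // v w /gH; rewrite GE => /e'P[vP wP].
  by rewrite !kP ?inE.
have GM : ~ embeds (matching s.+1) (adjacent G).
  case=> g [gI gH].
  have gm p : g p < 2 * s + 1.
    by have := gH _ _ (matching_partner p); rewrite GE => /e'P[].
  have hI : injective (pr \o g).
    move=> v w /(congr1 val); rewrite /= !prE // => E.
    by apply: gI; apply: val_inj.
  have := leq_card _ hI; rewrite card_prod card_bool !card_ord; lia.
rewrite -(leq_pmul2l (ltn0Sn 1)) -eE.
apply: (@leq_trans (2 * #|edges G|)).
  rewrite -arcs_adjacent.
  have -> : arcs e setT = arcs (relpre (widen_ord sn) (adjacent G)) setT.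
    apply: eq_bigr => a _; congr #|pred_of_set _|; apply/setP=> b.
    by rewrite !inE /= GE -e'w.
  by apply: arcs_relpre_le => a b /(congr1 val)/= /val_inj.
rewrite leq_mul2l /=; apply: (@leq_bigmax_cond _ _ (fun G => #|edges G|) G).
by apply/asboolP => H [->|->]; apply/has_subgraphP.
Qed.
End LowerBound.

Lemma growth_iter (x : nat -> nat) m1 a b :
    (forall m, m1 <= m -> 5 * x m + 3 * m <= 5 * x m.+1) ->
  m1 <= a -> a <= b -> 5 * x a + 3 * (a * (b - a)) <= 5 * x b.
Proof.
move=> xP ma; elim: b => [|b IHb]; first by rewrite leqn0 => /eqP->; rewrite muln0 addn0.
rewrite leq_eqVlt => /predU1P[->|]; first by rewrite subnn muln0 addn0.
rewrite ltnS => ab; have := IHb ab; have := xP b (leq_trans ma ab).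
rewrite subSn // mulnS; lia.
Qed.

Section UpperBound.
Variables (F : graph) (m1 n s : nat).
Notation x m := (ex m (family1 F)).
Hypothesis growth : forall m, m1 <= m -> 5 * x m + 3 * m <= 5 * x m.+1.
Hypotheses (sm : m1 < s) (s_n : 1999 * n <= 4000 * s) (sn : 2 * s < n).

Lemma ex_family2_le : ex n (family2 F (matching s.+1)) <= x (2 * s + 1).
Proof.
apply/bigmax_leqP => G /asboolP Gfree.
have nF : ~ embeds F (adjacent G) by move/has_subgraphP; apply/negP/(Gfree F); left.
have nM : ~ embeds (matching s.+1) (adjacent G) by move/has_subgraphP; apply/negP/(Gfree (matching s.+1)); right.
have eS := adjacent_simple G; set e := adjacent G in nF nM eS.
pose D : {set 'I_n} := [set v | 20 * #|nbr e v| <= 11 * n].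
have degD (S : {set 'I_n}) : S \subset D -> 20 * \sum_(v in S) #|nbr e v| <= 11 * (n * #|S|).
  move=> SD; rewrite mulnA [X in _ <= X]mulnC -sum_nat_const big_distrr /=.
  by apply: leq_sum => v /(subsetP SD); rewrite inE.
have del (S : {set 'I_n}) : #|edges G| <= x (n - #|S|) + \sum_(v in S) #|nbr e v|.
  have := arcs_delete S eS; rewrite {1}/e arcs_adjacent => h.
  have := arcs_in_le_ex (~: S) eS nF.
  have -> : #|~: S| = n - #|S| by have := cardsC S; rewrite card_ord; lia.
  lia.
(* Deleting [k = n %/ 100] vertices of [D] costs at most [0.55 * n] edges each. Since [n - 2 * s] is
   at most [n / 2000], at least [0.95 * k] growth steps of size at least [0.6 * 0.99 * n] remain,
   and [0.6 * 0.99 * 0.95 > 0.55]. *)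
have [Dbig | Dsmall] := ltnP n (100 * #|D|).
  have n100 : n %/ 100 <= #|D| by rewrite -(@mulKn #|D| 100) // leq_div2r // ltnW.
  have [S [SD Sn]] := exists_subset_card n100.
  have := degD S SD; have := del S; rewrite Sn.
  have : n - n %/ 100 + n %/ 100 = n by rewrite subnK // leq_div.
  have := leq_trunc_div n 100; have := ltn_ceil n (isT : 0 < 100).
  move: (n %/ 100) => k n1 n2 nk e1 e2.
  have kq : n - k <= 2 * s + 1 by lia.
  have := growth_iter growth (_ : m1 <= n - k) kq.
  move: (n - k) nk kq e1 => q nk kq e1 /(_ ltac:(lia)).
  have : 95 * k <= 100 * (2 * s + 1 - q) by lia.
  move: (2 * s + 1 - q) => j jk gr.
  have : 99 * n <= 100 * q by lia.
  move=> /leq_mul/(_ jk); lia.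
(* Now all of [D] is deleted, at a cost of at most [(0.55 + 0.02) * n * #|P|] edges. There are at
   least [#|P|] growth steps, each gaining at least [0.6 * 0.99 * n]. *)
have [|P [PD Pn Psum]] := edges_touching_le (D := D) eS nM.
  by move=> v; rewrite inE -ltnNge card_ord; lia.
rewrite card_ord in Pn.
have := del D; have := degD P PD.
have : n - #|D| + #|D| = n by rewrite subnK // -[leqRHS]card_ord max_card.
have qs : n - #|D| <= 2 * s + 1 by lia.
have := growth_iter growth (_ : m1 <= n - #|D|) qs.
move: Psum Pn Dsmall qs; move: (#|P|) (#|D|) (n - #|D|) => p d q Psum Pn Dsmall qs gr nqd.
have {gr} := gr ltac:(lia).
have pj : p <= 2 * s + 1 - q by lia.
have q99 : 99 * n <= 100 * q by lia.
have := leq_mul q99 pj; have := leq_mul (leqnn p) Dsmall.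
move: (2 * s + 1 - q) => j; lia.
Qed.
End UpperBound.

Local Open Scope ring_scope.

Theorem theorem1p3 (R : realType) (F : graph)
    (hF : (3 < chromatic_number F)%N) :
  exists (beta : R) (s0 : nat), 0 < beta /\
    forall n s : nat,
      Num.max s0%:R (n%:R / 2 - beta * n%:R) < s%:R :> R ->
      s%:R < n%:R / 2 :> R ->
      ex n (family2 F (matching s.+1)) = ex (2 * s + 1)%N (family1 F).
Proof.
move: hF; rewrite /chromatic_number; case: ex_minnP => -[//|r] Fr1 rmin r2.
have Fr : ~~ colorable F r by apply/negP=> /rmin; rewrite ltnn.
have r0 : (0 < r)%N by case: (r) r2.
have [m1 growth] := ex_growth R r2 Fr Fr1.
(* This [beta] turns the lower bound on [s] into [1999 * n <= 4000 * s]; [s0] ensures both the range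
   of [growth] and room for [F] in [2 * s + 1] vertices. *)
exists 4000%:R^-1, (maxn m1 #|vertex F|); split; first by rewrite invr_gt0 ltr0n.
move=> n s; rewrite gt_max ltr_nat gtn_max => /andP[/andP[m1s Fs] lo] hi.
have sn : (2 * s < n)%N by rewrite -(ltr_nat R) natrM; lra.
have s_n : (1999 * n <= 4000 * s)%N.
  by rewrite -(ler_nat R) !natrM; lra.
apply/eqP; rewrite eqn_leq (ex_family2_le growth) //=.
by apply: ex_ge_family2 r0 Fr _ _; lia.
Qed.
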